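(* Let $H(a_1, a_2, \ldots, a_n)=\sum_{j=0}^m c_j h_j(a_1, a_2, \ldots, a_n)$ with real coefficients $c_j$ and let $-\infty \le r < s \le \infty$. Then $$H(a_1, \ldots, a_n) >0\quad\text{for all}\quad (a_1,\ldots,a_n) \in (r,s)^n\setminus\{(0,\ldots,0)\}$$ if and only if $H(a,a, \ldots,a) >0$ for all $a \in (r,s)\setminus\{0\}$.
   Context: For a nonnegative integer $j$, $h_j(a_1,\ldots,a_n)=\sum_{1\le i_1\le i_2\le\cdots\le i_j\le n}a_{i_1}a_{i_2}\cdots a_{i_j}$ is the complete homogeneous symmetric polynomial of degree $j$ in $n$ variables, with $h_0=1$. Here $n\ge1$ and $m\ge 0$ are integers, and $(r,s)\subset\mathbb{R}$ is an open interval, possibly unbounded. *)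

(* Defs.v *)
From HB Require Import structures.
From mathcomp Require Import all_boot all_order all_algebra.
From mathcomp Require Import constructive_ereal reals.

Set Implicit Arguments.
Unset Strict Implicit.
Unset Printing Implicit Defensive.

Import Order.TTheory GRing.Theory Num.Theory.
Local Open Scope ring_scope.

(* Complete homogeneous symmetric polynomial of degree j, evaluated at the
   point a: the index tuple t = (i_1, ..., i_j) ranges over the weakly
   increasing j-tuples of indices. For j = 0 the only tuple is empty, so the
   value is 1. *)
Definition hsym (R : realType) (n j : nat) (a : 'rV[R]_n) : R :=
  \sum_(t : j.-tuple 'I_n | sorted leq [seq nat_of_ord i | i <- t])
    \prod_(i <- t) a ord0 i.

Definition hcomb (R : realType) (n m : nat) (c : 'I_m.+1 -> R)
    (a : 'rV[R]_n) : R :=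
  \sum_(j < m.+1) c j * hsym j a.

(* Main.v *)
Require Import Defs.
From mathcomp Require Import all_boot all_order all_algebra.
From mathcomp Require Import constructive_ereal reals.
From mathcomp Require Import polyrcf ring.

(* With [n] variables, [h_j(a_1, ..., a_n)] is the divided difference of
   [x ^ (j + n - 1)] at [a_1, ..., a_n], so [H(a)] is the coefficient of degree
   [n - 1] of the remainder [r] of [f = \sum_j c_j x ^ (j + n - 1)] modulo
   [\prod_i (x - a_i)]. Taking all [a_i] equal gives
   [f^(n-1)(x) = (n - 1)! H(x, ..., x)]. The polynomial [g = f - r] vanishes at
   the [a_i] with multiplicity; if they are not all equal, iterating Rolle's
   theorem yields two distinct zeros of [g^(n-2)] in their convex hull. But
   [g^(n-1)(x) = (n - 1)! (H(x, ..., x) - H(a))], so if [H(a) <= 0] then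
   [g^(n-2)] is strictly increasing there, even when 0 lies in the hull. *)

Import Order.TTheory GRing.Theory Num.Theory.
Local Open Scope ring_scope.

(** * Rolle's theorem for zeros counted with multiplicity *)

Section Rolle.
Variables (R : rcfType) (P : pred R).
Hypothesis convP : forall u v w, P u -> P v -> u <= w <= v -> P w.

(* The bound on [count_mem] says that [g^`()] vanishes on [s] with multiplicity
   as soon as [g] does on [x :: l]. The last clause keeps the zeros from all
   collapsing to one point when the lemma is iterated. *)
Lemma rolle_interlace (g : {poly R}) (x : R) (l : seq R) :
    path <=%R x l -> all P (x :: l) -> all (root g) (x :: l) ->
  exists s : seq R,
    [/\ size s = size l, path <=%R x s, all P s,
        forall y, (count_mem y s <= if y \in x :: l
                     then (count_mem y (x :: l)).-1 else root g^`() y)%N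
      & ~~ constant (x :: l) ->
        has (> x) s /\ ((1 < size l)%N -> ~~ constant s)].
Proof.
elim: l x => [|b l IH] x /=.
  by move=> _ _ _; exists [::]; split.
move=> /andP[le_xb sbl] /and3P[Px Pb Pl] /and3P[gx gb gl].
have [] := IH b sbl; rewrite /= ?Pb ?gb ?Pl ?gl //.
move=> s [size_s sbs Ps count_s nconst_s].
have [min_s sort_s] : all (>= b) s /\ sorted <=%R s.
  by apply/andP; rewrite -le_path_sortedE.
move: sbl; rewrite le_path_sortedE => /andP[min_l sort_l].
(* A repeated zero [x = b] contributes [x] itself to the new list; otherwise Rolle gives a point [e]
   strictly between [x] and [b]. *)
have [eq_xb|neq_xb] := eqVneq x b.
  exists (x :: s); subst b; split=> //=.
  - by rewrite size_s.
  - by rewrite lexx.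
  - by rewrite Px.
  - move=> y; have := count_s y; rewrite !inE.
    by case: (eqVneq x y) => [_|_] /=; rewrite !add0n ?add1n.
  - rewrite ltxx /= => nconst_l; have [has_s _] := nconst_s nconst_l.
    split=> // _; apply/negP => /allP const_s.
    by case/hasP: has_s => z /const_s /eqP ->; rewrite /= ltxx.
have lt_xb : x < b by rewrite lt_def eq_sym neq_xb.
have [|e] := @poly_rolle _ x b g lt_xb; first by rewrite (rootP gx) (rootP gb).
rewrite in_itv /= => /andP[lt_xe lt_eb] g'e.
have gt_s z : z \in s -> e < z by move=> /(allP min_s) /(lt_le_trans lt_eb).
exists (e :: s); split=> //=.
- by rewrite size_s.
- rewrite (ltW lt_xe) le_path_sortedE sort_s andbT.
  by apply/allP => z /gt_s /ltW.
- by rewrite Ps (convP _ _ _ Px Pb) // !ltW.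
- have min_bl z : z \in b :: l -> b <= z.
    by rewrite inE => /predU1P[->//|/(allP min_l)].
  move=> y; have := count_s y; rewrite [y \in x :: _]inE.
  have [eq_ey|neq_ey] := eqVneq e y.
    subst y; rewrite (gt_eqF lt_xe) /= (count_memPn _); last first.
      by apply/negP => /gt_s; rewrite ltxx.
    case: ifPn => [/min_bl|_ _]; first by rewrite leNgt lt_eb.
    by rewrite rootE g'e eqxx.
  have [eq_xy|_ //] := eqVneq x y.
  subst y; rewrite /= add0n => _; rewrite (count_memPn _) //.
  by apply/negP => /gt_s /(lt_trans lt_xe); rewrite ltxx.
- move=> _; rewrite lt_xe; split=> //; rewrite ltnS -size_s.
  case: {+}s gt_s => //= z s' gt_s _.
  by rewrite gt_eqF // gt_s ?mem_head.
Qed.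

Lemma dvdp_deriv_exp (g : {poly R}) (x : R) (k : nat) :
  ('X - x%:P) ^+ k.+1 %| g -> ('X - x%:P) ^+ k %| g^`().
Proof.
move=> /dvdpP[q ->]; rewrite derivM deriv_exp derivXsubC mul1r dvdp_add //.
  by rewrite exprS mulrA dvdp_mull.
by rewrite dvdp_mull // -mulr_natl dvdp_mull.
Qed.

(** Each round of [rolle_interlace] differentiates once and drops one point, and the list stays
    nonconstant as long as two points are left. *)
Lemma rolle_iter (n : nat) (g : {poly R}) (l : seq R) :
    size l = n.+2 -> sorted <=%R l -> all P l -> ~~ constant l ->
    (forall y, ('X - y%:P) ^+ count_mem y l %| g) ->
  exists u v : R, [/\ u < v, P u, P v & root g^`(n) u && root g^`(n) v].
Proof.
have rootl (h : {poly R}) (s : seq R) :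
    (forall y, ('X - y%:P) ^+ count_mem y s %| h) -> all (root h) s.
  move=> dvd_h; apply/allP => y ys; rewrite -dvdp_XsubCl.
  by apply: dvdp_trans (dvd_h y); rewrite dvdp_exp // -has_count has_pred1.
elim: n g l => [|n IH] g l.
  case: l => [|u [|v []]] //= _ /andP[le_uv _] /and3P[Pu Pv _] nconst.
  move=> dvd_g; have /and3P[gu gv _] := rootl g [:: u; v] dvd_g.
  exists u, v; split=> //; last exact/andP.
  by rewrite lt_def le_uv andbT; move: nconst; rewrite andbT.
case: l => // x l [size_l] sl Pl nconst dvd_g.
have [s [size_s ss Ps count_s]] :=
  rolle_interlace _ _ _ sl Pl (rootl _ _ dvd_g).
move=> /(_ nconst) [_ nconst_s].
rewrite derivSn; apply: IH Ps _ _; rewrite ?size_s ?(path_sorted ss) //.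
  by rewrite nconst_s ?size_l.
(* At an old zero the bound on the count and the multiplicity both drop by one; any other point
   occurs at most once, and then as a root of the derivative. *)
move=> y; apply: dvdp_trans (dvdp_exp2l _ (count_s y)) _.
case: ifPn => [y_l|_]; last first.
  by case: (boolP (root _ y)) => [?|]; rewrite ?dvd1p // dvdp_XsubCl.
by apply: dvdp_deriv_exp; rewrite prednK // -has_count has_pred1.
Qed.

Lemma dvdp_derivn_exp (n : nat) (g : {poly R}) (x : R) :
  ('X - x%:P) ^+ n.+1 %| g -> root g^`(n) x.
Proof.
elim: n g => [|n IH] g; first by rewrite dvdp_XsubCl.
by move=> /dvdp_deriv_exp /IH; rewrite derivSn.
Qed.

End Rolle.

Lemma dvdp_prod_count (R : idomainType) (s : seq R) (y : R) :
  ('X - y%:P) ^+ count_mem y s %| \prod_(x <- s) ('X - x%:P).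
Proof.
elim: s => [|x s IH]; first by rewrite dvd1p.
rewrite big_cons /=; have [->|_] := eqVneq x y; last exact: dvdp_mull.
by rewrite exprS dvdp_mul.
Qed.

(** * Complete homogeneous polynomials as divided differences of powers *)

Section CompleteHomogeneous.
Variable R : comNzRingType.

(** The value of [h_j] at the entries of [s]: a monomial either avoids [x] or has a factor [x]. In
    the second case only the degree drops, hence the inner [fix]. *)
Fixpoint hseq (s : seq R) : nat -> R :=
  if s is x :: s' then
    fix h j := if j is j'.+1 then hseq s' j'.+1 + x * h j' else 1
  else fun j => (j == 0%N)%:R.

Arguments hseq : simpl never.

Lemma hseq0 s : hseq s 0 = 1.
Proof. by case: s. Qed.

Lemma hseq_consS x s j :
  hseq (x :: s) j.+1 = hseq s j.+1 + x * hseq (x :: s) j.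
Proof. by []. Qed.

(* The polynomial part of ['X^(M + n) / \prod_(x <- s) ('X - x%:P)], whose
   expansion at infinity is ['X^M * \sum_j h_j(s) 'X^-j]. *)
Definition hquo (s : seq R) (M : nat) : {poly R} :=
  \poly_(k < M.+1) hseq s (M - k).

(** This is Horner division by ['X - x%:P]: its recursion on coefficients is [hseq_consS]. *)
Lemma hquo_consS x s M :
  hquo s M.+1 = ('X - x%:P) * hquo (x :: s) M + (hseq (x :: s) M.+1)%:P.
Proof.
apply/polyP => -[|k]; rewrite coefD mulrBl coefB coefXM coefCM coefC !coef_poly.
  by rewrite !subn0 hseq_consS /=; ring.
rewrite /= subSS !ltnS addr0.
case: (ltngtP k M) => [lt_kM|//|->]; last by rewrite subnn !hseq0 mulr0 subr0.
  by rewrite -(subnSK lt_kM) hseq_consS; ring.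
by rewrite mulr0 subr0.
Qed.

(** By induction on [s]: dividing the old quotient by one more linear factor leaves a constant,
    which adds a multiple of the old product to the remainder. *)
Lemma modp_Xn_prod (s : seq R) (M : nat) :
  exists2 r : {poly R}, (size r <= size s)%N
    & 'X^(M + size s) = \prod_(x <- s) ('X - x%:P) * hquo s M + r.
Proof.
elim: s M => [|x s IH] M.
  exists 0; rewrite ?size_poly0 // big_nil mul1r addr0 addn0.
  apply/polyP => i; rewrite coefXn coef_poly ltnS /=.
  case: ltngtP => //= [lt_iM|->]; last by rewrite subnn hseq0.
  by rewrite /hseq subn_eq0 leqNgt lt_iM.
have [r size_r eq_r] := IH M.+1.
exists ((hseq (x :: s) M.+1)%:P * \prod_(y <- s) ('X - y%:P) + r).
  rewrite (leq_trans (size_polyD _ _)) // geq_max (leq_trans size_r) //= andbT.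
  by rewrite mul_polyC (leq_trans (size_scale_leq _ _)) // size_prod_XsubC.
by rewrite /= -addSnnS eq_r (hquo_consS x) big_cons; ring.
Qed.

(* [v] is the divided difference of [f] at the points of [l]. *)
Definition has_divdiff (l : seq R) (f : {poly R}) (v : R) : Prop :=
  exists q r : {poly R}, [/\ (size r <= size l)%N,
    f = \prod_(x <- l) ('X - x%:P) * q + r & r`_(size l).-1 = v].

Lemma has_divdiff_Xn (l : seq R) (j : nat) :
  (0 < size l)%N -> has_divdiff l 'X^(j + (size l).-1) (hseq l j).
Proof.
case: l => // x s _; case: j => [|j].
  by exists 0, 'X^(size s); rewrite size_polyXn mulr0 add0r coefXn eqxx.
have [r size_r eq_r] := modp_Xn_prod s j.+1.
set w := \prod_(y <- s) ('X - y%:P) in eq_r.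
(* The product [w] is monic of degree [size s] and [r] has smaller degree, so the top coefficient of
   the remainder is the constant in front of [w]. *)
exists (hquo (x :: s) j), ((hseq (x :: s) j.+1)%:P * w + r); split.
- rewrite (leq_trans (size_polyD _ _)) // geq_max (leq_trans size_r) //= andbT.
  by rewrite mul_polyC (leq_trans (size_scale_leq _ _)) // size_prod_XsubC.
- by rewrite /= eq_r (hquo_consS x) big_cons -/w; ring.
- rewrite /= coefD coefCM (nth_default _ size_r) addr0.
  have := monic_prod_XsubC s xpredT id.
  by rewrite monicE /lead_coef size_prod_XsubC -/w => /eqP ->; rewrite mulr1.
Qed.

Lemma has_divdiff_sum (l : seq R) (m : nat) (c : 'I_m -> R) :
    (0 < size l)%N ->
  has_divdiff l (\sum_(j < m) c j *: 'X^(j + (size l).-1))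
    (\sum_(j < m) c j * hseq l j).
Proof.
move=> l_gt0; apply: big_ind2.
- by exists 0, 0; rewrite size_poly0 mulr0 addr0 coef0.
- move=> f u g v [q [r [size_r -> <-]]] [q' [r' [size_r' -> <-]]].
  exists (q + q'), (r + r'); split; last by rewrite coefD.
    by rewrite (leq_trans (size_polyD _ _)) // geq_max size_r.
  by ring.
- move=> j _; have [q [r [size_r -> <-]]] := has_divdiff_Xn l j l_gt0.
  exists (c j *: q), (c j *: r); split; last by rewrite coefZ.
    exact: leq_trans (size_scale_leq _ _) size_r.
  by rewrite scalerDr scalerAr.
Qed.

Lemma derivn_small (n : nat) (p : {poly R}) :
  (size p <= n.+1)%N -> p^`(n) = (p`_n *+ n`!)%:P.
Proof.
move=> size_p; apply/polyP => i; rewrite coef_derivn coefC.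
case: i => [|i]; first by rewrite addn0 ffactnn.
by rewrite nth_default ?mul0rn // (leq_trans size_p) // addnS ltnS leq_addr.
Qed.

End CompleteHomogeneous.

Arguments hseq {R} s j : simpl never.

(** * Positivity at nonconstant points *)

Lemma hseq_comb_gt0 (R : rcfType) (P : pred R) (m : nat) (c : 'I_m -> R)
    (l : seq R) :
    (forall u v w, P u -> P v -> u <= w <= v -> P w) ->
    (forall x, P x -> x != 0 ->
       0 < \sum_(j < m) c j * hseq (nseq (size l) x) j) ->
    all P l -> ~~ constant l ->
  0 < \sum_(j < m) c j * hseq l j.
Proof.
move=> convP; case El: (size l) => [|[|n]].
- by rewrite (size0nil El).
- by case: l El => [|x []].
move=> diag_gt0 Pl nconst; rewrite ltNge; apply/negP.
have [|q [r [size_r eq_f r_n]]] := has_divdiff_sum _ l _ c; first by rewrite El.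
rewrite -{}r_n El /= in size_r eq_f * => r_le0.
set f := \sum_(j < m) _ in eq_f.
pose g := f - r.
(* The part of [f] divisible by [('X - x%:P) ^+ n.+2] contributes nothing at [x]; what is left,
   [r1 - r], contributes (n+1)! times H(x, ..., x) - H(l). *)
have dg_gt0 x : P x -> x != 0 -> 0 < (g^`(n.+1)).[x].
  move=> Px /(diag_gt0 x Px) Hx_gt0.
  have [|q1 [r1 [size_r1 eq_f1 r1_n]]] := has_divdiff_sum _ (nseq n.+2 x) _ c.
    by rewrite size_nseq.
  rewrite -{}r1_n size_nseq /= -/f in Hx_gt0 size_r1 eq_f1.
  rewrite /g eq_f1 -addrA derivnD hornerD.
  rewrite (rootP (dvdp_derivn_exp _ _ _ _ _)); last first.
    apply: dvdp_mulr; have := dvdp_prod_count _ (nseq n.+2 x) x.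
    by rewrite count_nseq /= eqxx mul1n.
  rewrite add0r derivn_small; last first.
    by rewrite (leq_trans (size_polyD _ _)) // geq_max size_polyN size_r1.
  rewrite hornerC pmulrn_lgt0 ?fact_gt0 // coefB subr_gt0.
  exact: le_lt_trans Hx_gt0.
have [|||||u [v [lt_uv Pu Pv /andP[/eqP gu /eqP gv]]]] :=
    rolle_iter _ P convP n g (sort <=%R l).
- by rewrite size_sort.
- exact: sort_le_sorted.
- by rewrite all_sort.
- apply: contra nconst => /(constantP 0)[x]; rewrite size_sort => sort_x.
  apply/(all_pred1_constant (x := x))/allP => y.
  by rewrite -(mem_sort <=%R) sort_x mem_nseq => /andP[].
- move=> y; rewrite /g eq_f addrK dvdp_mulr //.
  by rewrite -(perm_big _ (permEl (perm_sort <=%R l))) dvdp_prod_count.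
(* Mean value theorem; the last condition keeps the intermediate point away from 0, where [dg_gt0]
   says nothing. *)
have incr a b : u <= a -> a < b -> b <= v -> ~~ (a < 0 < b) ->
    (g^`(n)).[a] < (g^`(n)).[b].
  move=> le_ua lt_ab le_bv not0.
  have [x] := poly_mvt (g^`(n)) lt_ab; rewrite in_itv -derivnS /=.
  move=> /andP[lt_ax lt_xb] eq_x; rewrite -subr_gt0 eq_x mulr_gt0 ?subr_gt0 //.
  apply: dg_gt0; last by apply: contra not0 => /eqP <-; rewrite lt_ax.
  apply: convP Pu Pv _.
  by rewrite (le_trans le_ua (ltW lt_ax)) (le_trans (ltW lt_xb)).
(* If 0 lies strictly between [u] and [v], the increases from [u] to 0 and from 0 to [v] are
   chained. *)
have [/andP[lt_u0 lt_0v]|not0] := boolP (u < 0 < v); last first.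
  by have := incr u v (lexx u) lt_uv (lexx v) not0; rewrite gu gv ltxx.
have := incr u 0 (lexx u) lt_u0 (ltW lt_0v); rewrite ltxx andbF => /(_ isT).
have := incr 0 v (ltW lt_u0) lt_0v (lexx v); rewrite ltxx => /(_ isT).
by move=> lt0v /lt_trans /(_ lt0v); rewrite gu gv ltxx.
Qed.

(** * From sums over increasing tuples to the recursion on lists *)

Section Tuples.
Variables (R : realType) (n : nat) (a : 'rV[R]_n).

(** This is [h_j] in the variables of index at least [k]: [path leq k] bounds the smallest index
    from below. *)
Definition htail (k j : nat) : R :=
  \sum_(t : j.-tuple 'I_n | path leq k [seq nat_of_ord i | i <- t])
    \prod_(i <- t) a ord0 i.

Lemma htailS k j :
  htail k j.+1 = \sum_(i < n | (k <= i)%N) a ord0 i * htail i j.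
Proof.
transitivity (\sum_(p : 'I_n * j.-tuple 'I_n |
    (k <= p.1)%N && path leq p.1 [seq nat_of_ord i | i <- p.2])
    a ord0 p.1 * \prod_(i <- p.2) a ord0 i); last first.
  rewrite -(pair_big_dep (fun i : 'I_n => (k <= i)%N)
    (fun i (t : j.-tuple 'I_n) => path leq i [seq nat_of_ord i | i <- t])
    (fun i (t : j.-tuple 'I_n) => a ord0 i * \prod_(i <- t) a ord0 i)) /=.
  by apply: eq_bigr => i _; rewrite big_distrr.
rewrite /htail.
rewrite (reindex (fun p : 'I_n * j.-tuple 'I_n => [tuple of p.1 :: p.2])) /=.
  by apply: eq_bigr => p _; rewrite big_cons.
exists (fun t => (thead t, [tuple of behead t])) => [[i t]|t] _ /=.
  by congr pair; apply: val_inj.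
by apply: val_inj; rewrite /= [in RHS](tuple_eta t).
Qed.

Lemma htail_hseq j k : (k <= n)%N ->
  htail k j = hseq (drop k [seq a ord0 i | i <- enum 'I_n]) j.
Proof.
set s := map _ _.
have size_s : size s = n by rewrite size_map size_enum_ord.
have htail0 k' : htail k' 0 = 1.
  rewrite /htail (big_pred1 [tuple]) ?big_nil // => t.
  by rewrite [t]tuple0 /= eqxx.
elim: j k => [|j IHj] k; first by rewrite htail0 hseq0.
(* Descending induction on [k], through [d = n - k], inside the induction on the degree. *)
move=> le_kn; rewrite -(subKn le_kn).
elim: (n - k)%N (leq_subr k n) => [|d IHd] lt_dn.
  rewrite subn0 drop_oversize ?size_s //= htailS big_pred0 // => i.
  by rewrite leqNgt ltn_ord.
have lt_kn : (n - d.+1 < n)%N by rewrite -subSn // subSS leq_subr.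
rewrite (drop_nth 0) ?size_s // hseq_consS -drop_nth ?size_s // -IHj 1?ltnW //.
rewrite subnSK // -IHd 1?ltnW // !htailS.
(* The term whose smallest index is [n - d.+1] gives the product in [hseq_consS]; the others form
   the sum for [n - d]. *)
rewrite (bigD1 (Ordinal lt_kn)) //= addrC; congr (_ + _ * _).
  apply: eq_bigl => i; rewrite -(inj_eq val_inj) /= -(subnSK lt_dn).
  by rewrite [RHS]ltn_neqAle eq_sym andbC.
rewrite /s (nth_map (Ordinal lt_kn)) ?size_enum_ord //; congr (a _ _).
by rewrite (nth_ord_enum _ (Ordinal lt_kn)).
Qed.

Lemma hsym_hseq j : hsym j a = hseq [seq a ord0 i | i <- enum 'I_n] j.
Proof.
rewrite -[map _ _]drop0 -htail_hseq // /hsym /htail; apply: eq_bigl => t.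
by case: [seq _ | _ <- _].
Qed.

End Tuples.

Theorem theorem3 (R : realType) (n m : nat) (n_ge1 : (1 <= n)%N)
    (c : 'I_m.+1 -> R) (r s : \bar R) (lt_rs : (r < s)%E) :
  (forall a : 'rV[R]_n,
      (forall i : 'I_n, (r < (a ord0 i)%:E < s)%E) -> a <> 0 ->
      0 < hcomb c a)
  <->
  (forall x : R, (r < x%:E < s)%E -> x <> 0 ->
      0 < hcomb c (const_mx x : 'rV[R]_n)).
Proof.
have hcombE (a : 'rV[R]_n) :
    hcomb c a = \sum_(j < m.+1) c j * hseq [seq a ord0 i | i <- enum 'I_n] j.
  by apply: eq_bigr => j _; rewrite hsym_hseq.
split=> [pos x rxs x_neq0 | pos a ras a_neq0].
  apply: pos => [i|]; first by rewrite mxE.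
  by move=> /matrixP /(_ ord0 (Ordinal n_ge1)); rewrite !mxE.
have [/(constantP 0)[x]|nconst] :=
    boolP (constant [seq a ord0 i | i <- enum 'I_n]).
  rewrite size_map size_enum_ord => a_x.
  have ax i : a ord0 i = x.
    have : a ord0 i \in nseq n x by rewrite -a_x map_f ?mem_enum.
    by rewrite mem_nseq => /andP[_ /eqP].
  have -> : a = const_mx x by apply/rowP => i; rewrite mxE ax.
  apply: pos => [|x0]; first by rewrite -(ax (Ordinal n_ge1)).
  by apply: a_neq0; apply/rowP => i; rewrite ax mxE.
rewrite hcombE.
apply: (hseq_comb_gt0 _ (fun x : R => (r < x%:E < s)%E)) nconst.
- move=> u v w /andP[lt_ru _] /andP[_ lt_vs] /andP[le_uw le_wv].
  by rewrite (lt_le_trans lt_ru) ?lee_fin // (le_lt_trans _ lt_vs) ?lee_fin.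
- move=> x rxs /eqP x_neq0; have := pos x rxs x_neq0; rewrite hcombE.
  suff -> : [seq (const_mx x : 'rV[R]_n) ord0 i | i <- enum 'I_n] =
      nseq (size [seq a ord0 i | i <- enum 'I_n]) x by [].
  rewrite size_map; elim: (enum _) => //= i e ->; by rewrite mxE.
- by apply/allP => _ /mapP[i _ ->]; apply: ras.
Qed.
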